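(* Let $A\in\mathbb{C}^{n\times n}$ be a Hermitian matrix, and let the columns of the matrices $X,Y\in\mathbb{C}^{n\times p}$ form orthonormal bases of subspaces $\mathcal{X}$ and $\mathcal{Y}$ of $\mathbb{C}^n$, respectively, with $\dim(\mathcal{X})=\dim(\mathcal{Y})=p$. Assume $\Theta(\mathcal{X},\mathcal{Y})<\pi/2$ (all principal angles are less than $\pi/2$). Then $$\left|\Lambda(X^HAX)-\Lambda(Y^HAY)\right|^2\prec_w \frac{\left\{S(P_{\mathcal{Y}}R_X)+S(P_{\mathcal{X}}R_Y)\right\}^2}{\cos^2(\Theta^{\downarrow}(\mathcal{X},\mathcal{Y}))}.$$ In addition, if the subspace $\mathcal{X}$ is $A$-invariant, then $$\left|\Lambda(X^HAX)-\Lambda(Y^HAY)\right|^2\prec_w \frac{S^2(P_{\mathcal{X}}R_Y)}{\cos^2(\Theta^{\downarrow}(\mathcal{X},\mathcal{Y}))}.$$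
   Context: $\Lambda(\cdot)$ is the vector of eigenvalues of a Hermitian matrix in decreasing order. $S(\cdot)$ is the vector of singular values of a matrix in decreasing order (for an $n\times p$ matrix with $p\le n$, it has $p$ entries), and $S^2(\cdot)$ is its entry-wise square. $R_X=AX-X(X^HAX)$ and $R_Y=AY-Y(Y^HAY)$ are the residual matrices. $P_{\mathcal{X}}$, $P_{\mathcal{Y}}$ are the orthogonal projectors onto $\mathcal{X}$, $\mathcal{Y}$. The principal angles between $\mathcal{X}$ and $\mathcal{Y}$ lie in $[0,\pi/2]$ and are the numbers whose cosines are the singular values of $X^HY$; $\Theta(\mathcal{X},\mathcal{Y})=\Theta^{\downarrow}(\mathcal{X},\mathcal{Y})$ is the vector of these $p$ angles in decreasing order. A subspace $\mathcal{X}$ is $A$-invariant if $A\mathcal{X}\subset\mathcal{X}$. All operations on vectors (sum, product, quotient, square, absolute value, cosine) are entry-wise, in the given orderings. For $x,y\in\mathbb{R}^m$, $x\prec_w y$ (weak majorization) means that, after rearranging the entries of each vector in decreasing order $x_1\ge\dots\ge x_m$, $y_1\ge\dots\ge y_m$, one has $\sum_{i=1}^k x_i\le\sum_{i=1}^k y_i$ for all $1\le k\le m$. *)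

(* Defs.v *)
From mathcomp Require Import all_boot all_order all_algebra.
From mathcomp Require Import spectral complex.
From mathcomp Require Import reals trigo.

Set Implicit Arguments.
Unset Strict Implicit.
Unset Printing Implicit Defensive.

Import Order.TTheory GRing.Theory Num.Theory.
Local Open Scope ring_scope.
Local Open Scope complex_scope.
Local Open Scope sesquilinear_scope.

(* Throughout, C = R[i] and M ^t* is the conjugate transpose M^H.  A subspace
   of C^n is the column space of an n x p matrix X, i.e. the row space of X^T
   in the sense of mxalgebra. *)

Definition decreasing (R : realType) (m : nat) (v : 'rV[R]_m) : 'rV[R]_m :=
  \row_(i < m) nth 0 (sort >=%R [seq v 0 j | j : 'I_m]) i.

(* Only meaningful for Hermitian M: spectral_diag lists the eigenvalues with
   multiplicity, as complex numbers which are then real. *)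
Definition eigvals (R : realType) (m : nat) (M : 'M[R[i]]_m) : 'rV[R]_m :=
  decreasing (\row_(j < m) complex.Re (spectral_diag M 0 j)).

(* Square roots of the eigenvalues of M^H M, hence p entries for M n x p;
   intended for p <= n. *)
Definition singvals (R : realType) (n p : nat) (M : 'M[R[i]]_(n, p)) :
    'rV[R]_p :=
  map_mx Num.sqrt (eigvals (M ^t* *m M)).

(* X and Y are expected to have orthonormal columns; the singular values of
   X^H Y then lie in [0, 1], and acos maps them into [0, pi / 2]. *)
Definition principal_angles (R : realType) (n p : nat)
    (X Y : 'M[R[i]]_(n, p)) : 'rV[R]_p :=
  decreasing (map_mx acos (singvals (X ^t* *m Y))).

(* Orthogonal projector onto the column space of X; proj_ortho acts on row
   vectors from the right, hence the transposes. *)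
Definition orthoproj (R : realType) (n p : nat) (X : 'M[R[i]]_(n, p)) :
    'M[R[i]]_n :=
  (proj_ortho X^T)^T.

Definition residual (R : realType) (n p : nat) (A : 'M[R[i]]_n)
    (X : 'M[R[i]]_(n, p)) : 'M[R[i]]_(n, p) :=
  A *m X - X *m (X ^t* *m A *m X).

(* A (col span X) is contained in col span X, written with transposes. *)
Definition invariant_colspace (R : realType) (n p : nat) (A : 'M[R[i]]_n)
    (X : 'M[R[i]]_(n, p)) : bool :=
  stablemx X^T A^T.

Definition weakly_majorized (R : realType) (m : nat) (x y : 'rV[R]_m) : Prop :=
  forall k : nat, (1 <= k <= m)%N ->
    \sum_(i < m | (i < k)%N) decreasing x 0 i
      <= \sum_(i < m | (i < k)%N) decreasing y 0 i.

Notation "x '≺w' y" := (weakly_majorized x y)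
  (at level 70, no associativity) : ring_scope.

(* Main.v *)
Require Import Defs.
From mathcomp Require Import all_boot all_order all_algebra all_fingroup.
From mathcomp Require Import spectral complex.
From mathcomp Require Import reals trigo.
From mathcomp Require Import ring lra.

(** Put [T = X^H Y], [M = X^H A X], [N = Y^H A Y] and [E = M T - T N]. Expanding
    the residuals gives [E = X^H R_Y - (Y^H R_X)^H]. As [P_X = X X^H] with [X]
    an isometry, [P_X R_Y] and [X^H R_Y] have the same singular values, so the
    Ky Fan triangle inequality bounds [S(E)] by [S(P_Y R_X) + S(P_X R_Y)] in
    weak majorization. If the column space of [X] is invariant then [R_X = 0]
    and only [S(P_X R_Y)] is left. The singular values of [T] are the cosines
    of the principal angles, so what remains is to bound the differences of the
    eigenvalues of [M] and [N] in terms of [E] and [T]: this is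
    [eigvals_diff_sqr_le].

    By a singular value decomposition of [T] (lemma [svd]) one may assume that
    [T] is diagonal and positive, hence that [T = G G] with [G] diagonal. Then
    [F = G^-1 E G^-1] equals [G^-1 M G - G N G^-1]. By Lidskii's inequality
    (lemma [lidskii_abs]) the vector of differences [|Lambda(M) - Lambda(N)|]
    is weakly majorized by the absolute eigenvalues of [K = M - N]. Now [K] is
    similar to [G^-1 K G], which has the same Hermitian part as [F]; a Schur
    triangularization of [G^-1 K G] therefore displays the eigenvalues of [K]
    as real parts of diagonal entries of a unitary conjugate of [F], and
    Ky Fan's principle bounds their sums by sums of singular values of [F]
    (lemma [sum_abs_eigvals_le]). So the differences are weakly majorized by
    [S(F)], and their squares by [S^2(F)].

    Finally, undoing each multiplication by [G^-1] weights the squared singular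
    values by the squared diagonal entries of [G^-1] in decreasing order (lemma
    [sqr_singvals_diag_mul_le]). The two factors together produce the weights
    [1 / s_i (T) ^ 2] in decreasing order, that is, the reciprocals of the
    squared cosines of the decreasing angles.

    Weak majorization is handled through the partial sums [topsum] of
    decreasing sequences; Abel summation (lemma [weighted_topsum_le]) carries
    the inequalities between partial sums over to decreasing weights and to
    squares. *)

Set Implicit Arguments.
Unset Strict Implicit.
Unset Printing Implicit Defensive.

Import Order.TTheory GRing.Theory Num.Theory.
Local Open Scope ring_scope.
Local Open Scope complex_scope.
Local Open Scope sesquilinear_scope.

(** * Partial sums of decreasing real sequences *)

Section RealSequences.
Variable R : realType.

Definition antitone p (f : 'I_p -> R) :=
  forall i j : 'I_p, (i <= j)%N -> f j <= f i.

Definition topsum p (f : 'I_p -> R) (k : nat) : R :=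
  \sum_(i < p | (i < k)%N) f i.

Lemma topsum0 p (f : 'I_p -> R) : topsum f 0 = 0.
Proof. by rewrite /topsum big_pred0. Qed.

Lemma topsumS p (f : 'I_p -> R) k (lt_kp : (k < p)%N) :
  topsum f k.+1 = topsum f k + f (Ordinal lt_kp).
Proof.
rewrite /topsum (bigD1 (Ordinal lt_kp)) //= addrC; congr (_ + _).
apply: eq_bigl => i; rewrite -val_eqE /= ltnS.
by case: ltngtP.
Qed.

Lemma ler_topsum p (f g : 'I_p -> R) k :
  (forall i, f i <= g i) -> topsum f k <= topsum g k.
Proof. by move=> le_fg; apply: ler_sum => i _. Qed.

Lemma eq_topsum p (f g : 'I_p -> R) k : f =1 g -> topsum f k = topsum g k.
Proof. by move=> eq_fg; apply: eq_bigr => i _. Qed.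

Lemma topsum_full p (f : 'I_p -> R) : topsum f p = \sum_i f i.
Proof. by apply: eq_bigl => i; rewrite ltn_ord. Qed.

Lemma card_ord_lt p k : (k <= p)%N -> #|[set i : 'I_p | (i < k)%N]| = k.
Proof.
move=> le_kp; rewrite -[RHS]card_ord -sum1_card -[RHS]sum1_card.
rewrite (big_ord_widen p (fun=> 1%N) le_kp).
by apply: eq_bigl => i; rewrite inE.
Qed.

Lemma topsum_indicator p k : (k <= p)%N ->
  \sum_(i < p) (i < k)%N%:R = k%:R :> R.
Proof.
move=> le_kp; rewrite -[in RHS](card_ord_lt le_kp) -natr_sum; congr _%:R.
rewrite -sum1_card [RHS]big_mkcond; apply: eq_bigr => i _.
by rewrite inE; case: ifP.
Qed.

(** The termwise comparison behind every Ky Fan principle below: with [c] the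
    smallest of the top [k] values of [f], each term
    [(f i - c) * (w i - [i < k])] is nonpositive, and subtracting the constant
    [c] changes nothing because both weight families have total mass [k]. *)
Lemma antitone_weighted_le p (f w : 'I_p -> R) k : (k <= p)%N -> antitone f ->
    (forall i, 0 <= w i <= 1) -> \sum_i w i = k%:R ->
  \sum_i f i * w i <= topsum f k.
Proof.
move=> le_kp f_anti w01 sum_w; case: k le_kp sum_w => [|k] le_kp sum_w.
  rewrite topsum0 big1 // => i _.
  by rewrite (psumr_eq0P _ sum_w) ?mulr0 // => j _; case/andP: (w01 j).
have w_tot : \sum_i (w i - (i < k.+1)%N%:R) = 0.
  by rewrite big_split /= sumrN topsum_indicator // sum_w subrr.
(* [k] has become [k.+1], so the smallest of the top values has index [k] *)
pose c := f (Ordinal le_kp).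
rewrite /topsum [leRHS]big_mkcond -subr_ge0 -sumrB /=.
rewrite -[X in _ <= X]addr0 -[X in _ + X](mulr0 c) -[X in _ + c * X]w_tot.
rewrite mulr_sumr -big_split /=.
apply: sumr_ge0 => i _.
have /andP[w0 w1] := w01 i.
case: ltnP => [lt_ik|le_ki] /=; rewrite ?mulr1n ?mulr0n.
  have := f_anti i (Ordinal le_kp) lt_ik; rewrite -/c; nra.
have := f_anti (Ordinal le_kp) i (ltnW le_ki); rewrite -/c; nra.
Qed.

Lemma antitone_sum_le p (f : 'I_p -> R) (J : {set 'I_p}) : antitone f ->
  \sum_(i in J) f i <= topsum f #|J|.
Proof.
move=> f_anti; have le_Jp : (#|J| <= p)%N.
  by rewrite -[X in (_ <= X)%N]card_ord max_card.
have -> : \sum_(i in J) f i = \sum_i f i * (i \in J)%:R.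
  rewrite big_mkcond; apply: eq_bigr => i _.
  by case: ifP; rewrite ?mulr1 ?mulr0.
apply: antitone_weighted_le => // [i|].
  by case: (i \in J); rewrite ?lexx ?ler01.
rewrite -natr_sum -sum1_card; congr _%:R; rewrite [RHS]big_mkcond.
by apply: eq_bigr => i _; case: ifP.
Qed.

(** Abel summation: a decreasing nonnegative weight is a positive combination
    of the indicators of the initial segments, so it preserves inequalities
    between partial sums. *)
Lemma weighted_topsum_le p (c x y : 'I_p -> R) k :
    antitone c -> (forall i, 0 <= c i) ->
    (forall m, (m <= p)%N -> topsum x m <= topsum y m) -> (k <= p)%N ->
  topsum (fun i => c i * x i) k <= topsum (fun i => c i * y i) k.
Proof.
move=> c_anti c_ge0 le_xy; pose z i := y i - x i.
have z_ge0 m : (m <= p)%N -> 0 <= topsum z m.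
  by move=> /le_xy le_m; rewrite /topsum sumrB subr_ge0.
suff main m (lt_mp : (m < p)%N) :
    c (Ordinal lt_mp) * topsum z m.+1 <= topsum (fun i => c i * z i) m.+1.
  case: k => [|k] le_kp; first by rewrite !topsum0.
  rewrite -subr_ge0 /topsum -sumrB; under eq_bigr do rewrite -mulrBr.
  by apply: le_trans (main k le_kp); apply: mulr_ge0; last exact: z_ge0.
elim: m lt_mp => [|m IHm] lt_mp; first by rewrite !topsumS !topsum0 !add0r.
rewrite [topsum z _]topsumS [leRHS]topsumS mulrDr lerD2r.
have lt_mp' := ltnW lt_mp.
apply: le_trans (IHm lt_mp'); apply: ler_wpM2r; first exact: z_ge0.
exact: c_anti.
Qed.

(** Since [y ^ 2 - x ^ 2 >= 2 * x * (y - x)], this follows from Abel summation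
    with the weight [x] itself. *)
Lemma topsum_sqr_le p (x y : 'I_p -> R) k :
    antitone x -> (forall i, 0 <= x i) ->
    (forall m, (m <= p)%N -> topsum x m <= topsum y m) -> (k <= p)%N ->
  topsum (fun i => x i ^+ 2) k <= topsum (fun i => y i ^+ 2) k.
Proof.
move=> x_anti x_ge0 le_xy le_kp.
have /= := weighted_topsum_le x_anti x_ge0 le_xy le_kp.
rewrite /topsum -subr_ge0 -sumrB => h.
rewrite -subr_ge0 -sumrB -[X in X <= _]addr0.
apply: le_trans (lerD h h) _; rewrite -big_split /=. apply: ler_sum => i _.
have := sqr_ge0 (y i - x i); rewrite !expr2; nra.
Qed.

(** The only access to the sorted vectors of the statement: everything else
    about [decreasing] follows from this rearrangement and from its
    monotonicity. *)
Lemma decreasing_perm m (v : 'rV[R]_m) :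
  exists s : 'S_m, forall i, decreasing v 0 i = v 0 (s i).
Proof.
pose t := [tuple v 0 j | j < m].
have szs : size (sort >=%R t) = m by rewrite size_sort size_tuple.
have : perm_eq (in_tuple (sort >=%R t)) t by rewrite perm_sort.
case/(@tuple_permP _ _ (sort >=%R t) t) => s E; exists s => i.
rewrite mxE /= -[[seq _ | j : 'I_m]]/(val t) E.
rewrite (nth_map i) ?size_enum_ord // nth_ord_enum tnth_mktuple //.
Qed.

Lemma decreasing_antitone m (v : 'rV[R]_m) : antitone (decreasing v 0).
Proof.
move=> i j le_ij; rewrite !mxE.
set s := sort _ _.
have szs : size s = m by rewrite size_sort size_image card_ord.
apply: (sorted_leq_nth (leT := >=%R) _ _ 0) => //.
- by move=> y x z /= ? ?; apply: le_trans; eassumption.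
- by move=> x /=.
- by apply: sort_sorted => x y; apply: le_total.
- by rewrite inE szs.
- by rewrite inE szs.
Qed.

Lemma topsum_perm_le p (f : 'I_p -> R) (g : 'I_p -> R) (s : 'S_p) k :
    antitone g -> (forall i, f i = g (s i)) -> (k <= p)%N ->
  topsum f k <= topsum g k.
Proof.
move=> g_anti f_g le_kp.
have := antitone_sum_le (s @: [set i : 'I_p | (i < k)%N]) g_anti.
rewrite card_imset ?card_ord_lt //; last exact: perm_inj.
rewrite big_imset /=; last by move=> ? ? _ _; apply: perm_inj.
rewrite /topsum; apply: le_trans; rewrite le_eqVlt; apply/orP; left; apply/eqP.
by apply: eq_big => i; rewrite ?inE.
Qed.

End RealSequences.


(** * Spectral decompositions and Weyl monotonicity *)

Section Spectrum.
Variable R : realType.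
Local Notation C := R[i].
Local Notation Rec := (@complex.Re R).

Definition sqmod (z : C) : R := complex.Re z ^+ 2 + complex.Im z ^+ 2.

Lemma sqmod_ge0 z : 0 <= sqmod z.
Proof. by rewrite addr_ge0 ?sqr_ge0. Qed.

Lemma mulCJ (z : C) : z * Num.conj z = (sqmod z)%:C.
Proof.
case: z => a b; apply/eqP; rewrite eq_complex /sqmod /=.
by apply/andP; split; apply/eqP; ring.
Qed.

Lemma mulJC (z : C) : Num.conj z * z = (sqmod z)%:C.
Proof. by rewrite mulrC mulCJ. Qed.

Lemma sqmod0 : sqmod 0 = 0.
Proof. by rewrite /sqmod /= expr0n addr0. Qed.

Lemma sqmod_eq0 z : sqmod z = 0 -> z = 0.
Proof.
case: z => a b /eqP; rewrite /sqmod /= paddr_eq0 ?sqr_ge0 // !sqrf_eq0.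
by case/andP => /eqP-> /eqP->.
Qed.

Lemma conjC_realc (x : R) : Num.conj x%:C = x%:C.
Proof. by rewrite -[LHS]/(conjc _) conjc_real. Qed.

Lemma cReD : {morph Rec : x y / x + y}.
Proof. by move=> [a b] [c d]. Qed.

Lemma cReB : {morph Rec : x y / x - y}.
Proof. by move=> [a b] [c d]. Qed.

Lemma cRe_sum I (r : seq I) (P : pred I) (F : I -> C) :
  Rec (\sum_(i <- r | P i) F i) = \sum_(i <- r | P i) Rec (F i).
Proof. exact: (big_morph Rec cReD (erefl _)). Qed.

Lemma cRe_real x : Rec x%:C = x. Proof. by []. Qed.

Lemma cReMr (x : R) z : Rec (x%:C * z) = x * Rec z.
Proof. by case: z => a b /=; rewrite mul0r subr0. Qed.

Lemma cRe_conj z : Rec (Num.conj z) = Rec z.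
Proof. by case: z. Qed.

Lemma realcM (x y : R) : (x * y)%:C = x%:C * y%:C.
Proof. exact: rmorphM. Qed.

Lemma realc_sum I (r : seq I) (P : pred I) (F : I -> R) :
  (\sum_(i <- r | P i) F i)%:C = \sum_(i <- r | P i) (F i)%:C.
Proof. exact: rmorph_sum. Qed.

Section Adjoint.
Variables m n q : nat.
Implicit Types A B : 'M[C]_(m, n).

Lemma adjM A (D : 'M[C]_(n, q)) : (A *m D)^t* = D^t* *m A^t*.
Proof. by rewrite trmx_mul map_mxM. Qed.

Lemma adjD A B : (A + B)^t* = A^t* + B^t*.
Proof. by apply/matrixP => i j; rewrite !mxE rmorphD. Qed.

Lemma adjN A : (- A)^t* = - A^t*.
Proof. by apply/matrixP => i j; rewrite !mxE rmorphN. Qed.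

Lemma adjB A B : (A - B)^t* = A^t* - B^t*.
Proof. by rewrite adjD adjN. Qed.

Lemma adjE A i j : A^t* i j = Num.conj (A j i).
Proof. by rewrite !mxE. Qed.

End Adjoint.

Lemma hermP m (M : 'M[C]_m) : reflect (M^t* = M) (M \is hermsymmx).
Proof.
apply: (iffP (is_hermitianmxP _ _ _)); rewrite expr0 scale1r => E.
  by rewrite -E.
by rewrite [RHS]E.
Qed.

Definition cdiag m (d : 'I_m -> R) : 'M[C]_m := diag_mx (\row_j (d j)%:C).

Lemma cdiag_mulE m n (d : 'I_m -> R) (A : 'M[C]_(m, n)) i j :
  (cdiag d *m A) i j = (d i)%:C * A i j.
Proof. by rewrite mul_diag_mx !mxE. Qed.

Lemma mul_cdiagE m n (A : 'M[C]_(n, m)) (d : 'I_m -> R) i j :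
  (A *m cdiag d) i j = (d j)%:C * A i j.
Proof. by rewrite mul_mx_diag !mxE mulrC. Qed.

Lemma cdiag_adj m (d : 'I_m -> R) : (cdiag d)^t* = cdiag d.
Proof.
apply/matrixP => i j; rewrite !mxE eq_sym; case: eqP => [->|_].
  by rewrite !mulr1n conjC_realc.
by rewrite !mulr0n rmorph0.
Qed.

Lemma cdiag_diag m (d : 'I_m -> R) i : cdiag d i i = (d i)%:C.
Proof. by rewrite !mxE eqxx. Qed.

Lemma cdiagM m (d e : 'I_m -> R) :
  cdiag d *m cdiag e = cdiag (fun i => d i * e i).
Proof. by apply/matrixP => i j; rewrite cdiag_mulE !mxE realcM mulrnAr. Qed.

Lemma eq_cdiag m (d e : 'I_m -> R) : d =1 e -> cdiag d = cdiag e.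
Proof. by move=> E; apply/matrixP => i j; rewrite !mxE E. Qed.

Lemma cdiag1 m (d : 'I_m -> R) : (forall i, d i = 1) -> cdiag d = 1%:M.
Proof. by move=> E; apply/matrixP => i j; rewrite !mxE E. Qed.

Lemma spectral_entry m n q (U : 'M[C]_(m, n)) (V : 'M[C]_(m, q)) d i j :
  (U^t* *m cdiag d *m V) i j =
  \sum_k (d k)%:C * (Num.conj (U k i) * V k j).
Proof.
rewrite mxE; apply: eq_bigr => k _.
by rewrite mul_cdiagE adjE mulrA.
Qed.

Lemma unitary_mul_adj m (U : 'M[C]_m) : U \is unitarymx -> U *m U^t* = 1%:M.
Proof. by move/unitarymxP. Qed.

Lemma unitary_adj_mul m (U : 'M[C]_m) : U \is unitarymx -> U^t* *m U = 1%:M.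
Proof. by move=> /unitarymxP; apply: mulmx1C. Qed.

Lemma mxE_adj_mul m n (U : 'M[C]_(m, n)) j :
  (U^t* *m U) j j = (\sum_i sqmod (U i j))%:C.
Proof. by rewrite mxE realc_sum; apply: eq_bigr => i _; rewrite adjE mulJC. Qed.

Lemma mxE_mul_adj m n (U : 'M[C]_(m, n)) i :
  (U *m U^t*) i i = (\sum_j sqmod (U i j))%:C.
Proof. by rewrite mxE realc_sum; apply: eq_bigr => j _; rewrite adjE mulCJ. Qed.

Lemma unitary_row_sum m (U : 'M[C]_m) i : U \is unitarymx ->
  \sum_j sqmod (U i j) = 1.
Proof.
move/unitary_mul_adj/matrixP/(_ i i).
by rewrite mxE_mul_adj mxE eqxx => /complexI.
Qed.

Lemma unitary_col_sum m (U : 'M[C]_m) j : U \is unitarymx ->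
  \sum_i sqmod (U i j) = 1.
Proof.
move/unitary_adj_mul/matrixP/(_ j j).
by rewrite mxE_adj_mul mxE eqxx => /complexI.
Qed.

Lemma adj_unitary m (U : 'M[C]_m) : U \is unitarymx -> U^t* \is unitarymx.
Proof. by rewrite trmxC_unitary. Qed.

Lemma perm_unitary m (s : 'S_m) : (perm_mx s : 'M[C]_m) \is unitarymx.
Proof.
by apply/unitarymxP; rewrite tr_perm_mx map_perm_mx -perm_mxM mulgV perm_mx1.
Qed.

(** Lets the eigenvalues of a spectral decomposition be listed in any order,
    in particular in decreasing order. *)
Lemma spectral_reindex m (U : 'M[C]_m) (d : 'I_m -> R) (s : 'S_m) :
  U^t* *m cdiag d *m U =
  (row_perm s U)^t* *m cdiag (d \o s) *m row_perm s U.
Proof.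
apply/matrixP => i j; rewrite !spectral_entry.
rewrite (reindex_inj (@perm_inj _ s)) /=.
by apply: eq_bigr => k _; rewrite !mxE.
Qed.

Lemma row_perm_unitary m (U : 'M[C]_m) (s : 'S_m) : U \is unitarymx ->
  row_perm s U \is unitarymx.
Proof. by move=> Uu; rewrite row_permE mul_unitarymx ?perm_unitary. Qed.

Lemma eig_decomposition m (M : 'M[C]_m) : M \is hermsymmx ->
  exists2 U : 'M[C]_m, U \is unitarymx & M = U^t* *m cdiag (eigvals M 0) *m U.
Proof.
move=> Mherm; have Mreal := hermitian_spectral_diag_real Mherm.
have /orthomx_spectralP := hermitian_normalmx Mherm.
have Uu := spectral_unitarymx M; rewrite invmx_unitary //.
have -> : diag_mx (spectral_diag M) =
          cdiag (fun j => complex.Re (spectral_diag M 0 j)).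
  congr diag_mx; apply/rowP => j; rewrite mxE RRe_real //.
  by move/mxOverP: Mreal.
have [s Es] := decreasing_perm (\row_j complex.Re (spectral_diag M 0 j)).
rewrite (spectral_reindex _ _ s) => EM.
exists (row_perm s (spectralmx M)); first exact: row_perm_unitary.
rewrite [LHS]EM; set d := (X in cdiag X).
have -> // : cdiag d = cdiag (eigvals M 0).
by apply: eq_cdiag => k; rewrite /d /= Es mxE.
Qed.

Definition qform m (M : 'M[C]_m) (v : 'rV[C]_m) : R :=
  complex.Re ((v *m M *m v^t*) 0 0).

Definition sqnorm m (v : 'rV[C]_m) : R := \sum_j sqmod (v 0 j).

Lemma sqnormE m (v : 'rV[C]_m) : (v *m v^t*) 0 0 = (sqnorm v)%:C.
Proof. exact: mxE_mul_adj. Qed.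

Lemma sqnorm_unitary m (v : 'rV[C]_m) (U : 'M[C]_m) : U \is unitarymx ->
  sqnorm (v *m U) = sqnorm v.
Proof.
move=> Uu; apply: complexI; rewrite -!sqnormE adjM mulmxA.
by rewrite -(mulmxA v) unitary_mul_adj // mulmx1.
Qed.

Lemma sqnorm_gt0 m (v : 'rV[C]_m) : v != 0 -> 0 < sqnorm v.
Proof.
move=> v0; rewrite lt_def sumr_ge0 ?andbT; last by move=> *; apply: sqmod_ge0.
apply: contraNneq v0 => /psumr_eq0P E; apply/eqP/rowP => j; rewrite mxE.
by apply/sqmod_eq0/E => // k _; apply: sqmod_ge0.
Qed.

Lemma qform_diag m (d : 'I_m -> R) (v : 'rV[C]_m) :
  qform (cdiag d) v = \sum_j d j * sqmod (v 0 j).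
Proof.
rewrite /qform mxE cRe_sum; apply: eq_bigr => j _.
by rewrite mul_cdiagE adjE -mulrA mulCJ -realcM.
Qed.

Lemma qform_conj m (M U : 'M[C]_m) (v : 'rV[C]_m) :
  qform (U^t* *m M *m U) v = qform M (v *m U^t*).
Proof. by rewrite /qform adjM trmxCK !mulmxA. Qed.

Lemma qformD m (M N : 'M[C]_m) v : qform (M + N) v = qform M v + qform N v.
Proof. by rewrite /qform mulmxDr mulmxDl mxE cReD. Qed.

Lemma qformB m (M N : 'M[C]_m) v : qform (M - N) v = qform M v - qform N v.
Proof. by rewrite /qform mulmxBr mulmxBl !mxE cReB. Qed.

(** A dimension count: the [i + 1]-dimensional space of vectors supported on the
    first [i + 1] coordinates contains a nonzero solution of [i] linear
    equations. *)
Lemma flag_meet m (N : 'M[C]_m) (i : 'I_m) :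
  exists v : 'rV[C]_m, [/\ v != 0, forall j : 'I_m, (i < j)%N -> v 0 j = 0
    & forall j : 'I_m, (j < i)%N -> (v *m N) 0 j = 0].
Proof.
pose w (a : 'I_i.+1) : 'I_m := widen_ord (ltn_ord i) a.
pose w' (a : 'I_i) : 'I_m := widen_ord (ltnW (ltn_ord i)) a.
pose A := \matrix_(a, b) N (w a) (w' b).
have : kermx A != 0.
  rewrite kermx_eq0 /row_free; apply: contraTneq (rank_leq_col A) => ->.
  by rewrite ltnn.
case/rowV0Pn => z /sub_kermxP zA z0.
pose v : 'rV[C]_m := \row_j \sum_a z 0 a * (w a == j)%:R.
have vw a : v 0 (w a) = z 0 a.
  rewrite mxE (bigD1 a) //= eqxx mulr1 big1 ?addr0 // => b ba.
  by rewrite -val_eqE /= (inj_eq val_inj) (negPf ba) mulr0.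
have v_out (j : 'I_m) : (i < j)%N -> v 0 j = 0.
  move=> lt_ij; rewrite mxE big1 // => a _.
  by rewrite -val_eqE /= ltn_eqF ?mulr0 // (leq_trans (ltn_ord a)).
exists v; split => //.
  apply: contra_neq z0 => E; apply/rowP => a.
  by rewrite -vw E !mxE.
move=> j lt_ji; have -> : j = w' (Ordinal lt_ji) by apply: val_inj.
have /rowP/(_ (Ordinal lt_ji)) := zA; rewrite [in RHS]mxE => <-.
rewrite !mxE; under eq_bigr => k _ do rewrite mxE mulr_suml.
rewrite exchange_big /=; apply: eq_bigr => a _.
rewrite [in RHS]mxE (bigD1 (w a)) //= eqxx mulr1 big1 ?addr0 // => k ka.
by rewrite eq_sym (negPf ka) mulr0 mul0r.
Qed.

(** The first [i + 1] eigenvectors of the left matrix and the eigenvectors of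
    the right one from the [i]-th on span spaces with a common nonzero vector
    [y *m U]. On it the left form is at least [b i] and the right form is at
    most [c i], in units of the squared norm. *)
Lemma weyl_monotone m (U V : 'M[C]_m) (b c : 'I_m -> R) tau :
    U \is unitarymx -> V \is unitarymx -> antitone b -> antitone c ->
    (forall v, qform (U^t* *m cdiag b *m U) v <=
               qform (V^t* *m cdiag c *m V) v + tau * sqnorm v) ->
  forall i, b i <= c i + tau.
Proof.
move=> Uu Vu b_anti c_anti le_BC i.
have [y [y0 y_hi y_lo]] := flag_meet (U *m V^t*) i.
have := le_BC (y *m U); rewrite !qform_conj mulmxtVK // -mulmxA.
rewrite sqnorm_unitary // !qform_diag => le_y.
have VU : U *m V^t* \is unitarymx by rewrite mul_unitarymx ?trmxC_unitary.
rewrite -(ler_pM2r (sqnorm_gt0 y0)) mulrDl.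
apply: le_trans (le_trans le_y _).
  rewrite mulr_sumr; apply: ler_sum => j _.
  case: (leqP j i) => [le_ji|/y_hi ->]; last by rewrite sqmod0 !mulr0.
  by apply: ler_wpM2r; rewrite ?sqmod_ge0 ?b_anti.
rewrite lerD2r -(sqnorm_unitary y VU) mulr_sumr; apply: ler_sum => j _.
case: (leqP i j) => [le_ij|/y_lo ->]; last by rewrite sqmod0 !mulr0.
by apply: ler_wpM2r; rewrite ?sqmod_ge0 ?c_anti.
Qed.

Lemma eigvals_antitone m (M : 'M[C]_m) : antitone (eigvals M 0).
Proof. exact: decreasing_antitone. Qed.

Lemma spectral_herm m (U : 'M[C]_m) d : U^t* *m cdiag d *m U \is hermsymmx.
Proof. by apply/hermP; rewrite !adjM trmxCK cdiag_adj mulmxA. Qed.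

(** Two spectral decompositions of the same matrix define the same quadratic
    form, so Weyl monotonicity bounds each sorted spectrum by the other. *)
Lemma eigvals_unique m (M U : 'M[C]_m) (d : 'I_m -> R) :
    U \is unitarymx -> antitone d -> M = U^t* *m cdiag d *m U ->
  forall i, eigvals M 0 i = d i.
Proof.
move=> Uu d_anti EM i.
have [V Vu EV] : exists2 V : 'M[C]_m, V \is unitarymx &
    M = V^t* *m cdiag (eigvals M 0) *m V.
  by apply: eig_decomposition; rewrite EM spectral_herm.
have e_anti := eigvals_antitone M.
apply/eqP; rewrite eq_le; apply/andP; split.
  rewrite -[leRHS]addr0; apply: (weyl_monotone Vu Uu) => // v.
  by rewrite mul0r addr0 -EV -EM.
rewrite -[leRHS]addr0; apply: (weyl_monotone Uu Vu) => // v.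
by rewrite mul0r addr0 -EV -EM.
Qed.

End Spectrum.


(** * Singular value decomposition *)

Section SingularValues.
Variable R : realType.
Local Notation C := R[i].

(** Both sides are computed from the determinant of the block matrix with
    rows [(X, A)] and [(B, 1)], by clearing [B] by column or by row
    operations. *)
Lemma char_poly_mulC n (A B : 'M[C]_n) :
  char_poly (A *m B) = char_poly (B *m A).
Proof.
pose A' := map_mx polyC A; pose B' := map_mx polyC B.
pose M := block_mx 'X%:M A' B' 1%:M.
have detAB : \det M = char_poly (A *m B).
  have E : M *m block_mx 1%:M 0 (- B') 1%:M =
           block_mx (char_poly_mx (A *m B)) A' 0 1%:M.
    rewrite mulmx_block !mulmx1 !mulmx0 !mul1mx !add0r subrr.
    by rewrite mulmxN /char_poly_mx map_mxM.
  move/(congr1 determinant): E.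
  by rewrite det_mulmx det_lblock det_ublock !det1 !mulr1.
have detBA : 'X^n * \det M = 'X^n * char_poly (B *m A).
  have E : block_mx 1%:M 0 (- B') 'X%:M *m M =
           block_mx 'X%:M A' 0 (char_poly_mx (B *m A)).
    rewrite mulmx_block !mulmx1 !mul1mx !mul0mx !addr0.
    rewrite scalar_mxC mulmxN addNr [in LHS]addrC.
    by rewrite mulNmx /char_poly_mx map_mxM.
  move/(congr1 determinant): E.
  by rewrite det_mulmx det_lblock det_ublock !det1 !mul1r det_scalar.
rewrite -detAB; apply: (mulfI _ detBA).
by rewrite expf_neq0 // polyX_eq0.
Qed.

Lemma char_poly_cdiag m (d : 'I_m -> R) :
  char_poly (cdiag d) = \prod_i ('X - (d i)%:C%:P).
Proof.
rewrite char_poly_trig; last exact: diag_mx_is_trig.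
by apply: eq_bigr => i _; rewrite !mxE eqxx.
Qed.

Lemma char_poly_spectral m (U : 'M[C]_m) (d : 'I_m -> R) : U \is unitarymx ->
  char_poly (U^t* *m cdiag d *m U) = \prod_i ('X - (d i)%:C%:P).
Proof.
move=> Uu; rewrite char_poly_mulC mulmxA (unitary_mul_adj Uu) mul1mx.
exact: char_poly_cdiag.
Qed.

Lemma prod_XsubC_perm m (d e : 'I_m -> C) :
    \prod_i ('X - (d i)%:P) = \prod_i ('X - (e i)%:P) ->
  exists s : 'S_m, forall i, d i = e (s i).
Proof.
pose t (f : 'I_m -> C) := [tuple f i | i < m].
have Et f : \prod_i ('X - (f i)%:P) = \prod_(x <- t f) ('X - x%:P).
  by rewrite big_map big_enum.
rewrite !Et => /prod_XsubC_eq /tuple_permP [s Es].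
exists s => i; have := congr1 (fun u => nth 0 u i) Es.
rewrite -[in LHS](tnth_nth 0 (t d)).
rewrite -[in RHS](tnth_nth 0 [tuple tnth (t e) (s j) | j < m]).
by rewrite !tnth_mktuple.
Qed.

Lemma eigvals_char_poly m (M N : 'M[C]_m) :
  M \is hermsymmx -> N \is hermsymmx ->
  char_poly M = char_poly N -> eigvals M = eigvals N.
Proof.
move=> /eig_decomposition [U Uu EM] /eig_decomposition [V Vu EN].
rewrite [in LHS]EM [in RHS]EN !char_poly_spectral // => /esym E.
have [s Es] := prod_XsubC_perm E.
have Ediag : cdiag (eigvals M 0 \o s) = cdiag (eigvals N 0).
  by apply: eq_cdiag => j /=; apply: complexI; rewrite Es.
apply/rowP => i; apply: (@eigvals_unique _ _ _ (row_perm s U)).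
- exact: row_perm_unitary.
- exact: eigvals_antitone.
by rewrite -Ediag -spectral_reindex.
Qed.

Lemma gram_herm n p (F : 'M[C]_(n, p)) : F^t* *m F \is hermsymmx.
Proof. by apply/hermP; rewrite adjM trmxCK. Qed.

Lemma gram_herm_r n p (F : 'M[C]_(n, p)) : F *m F^t* \is hermsymmx.
Proof. by apply/hermP; rewrite adjM trmxCK. Qed.

Lemma gram_eigvals_ge0 n p (F : 'M[C]_(n, p)) i : 0 <= eigvals (F^t* *m F) 0 i.
Proof.
have [V Vu EV] := eig_decomposition (gram_herm F).
have : (F *m V^t*)^t* *m (F *m V^t*) = cdiag (eigvals (F^t* *m F) 0).
  rewrite adjM trmxCK -mulmxA (mulmxA (F^t*)) [in LHS]EV.
  by rewrite !mulmxA unitary_mul_adj // mul1mx mulmxtVK.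
move/matrixP/(_ i i); rewrite mxE_adj_mul cdiag_diag => /complexI <-.
by apply: sumr_ge0 => *; apply: sqmod_ge0.
Qed.

Lemma singvals_ge0 n p (F : 'M[C]_(n, p)) i : 0 <= singvals F 0 i.
Proof. by rewrite mxE sqrtr_ge0. Qed.

Lemma sqr_singvals n p (F : 'M[C]_(n, p)) i :
  singvals F 0 i ^+ 2 = eigvals (F^t* *m F) 0 i.
Proof. by rewrite mxE sqr_sqrtr ?gram_eigvals_ge0. Qed.

Lemma singvals_antitone n p (F : 'M[C]_(n, p)) : antitone (singvals F 0).
Proof.
move=> i j le_ij; rewrite [leLHS]mxE [leRHS]mxE.
by rewrite ler_sqrt ?gram_eigvals_ge0 // eigvals_antitone.
Qed.

(** Any factorization of the shape of a singular value decomposition exhibits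
    the singular values; this is how their invariance properties are derived
    below. *)
Lemma singvals_svd p (F U V : 'M[C]_p) d : U \is unitarymx -> V \is unitarymx ->
    antitone d -> (forall i, 0 <= d i) -> F = U^t* *m cdiag d *m V ->
  forall i, singvals F 0 i = d i.
Proof.
move=> Uu Vu d_anti d0 EF i.
apply: (@pexpIrn _ 2) => //; rewrite ?nnegrE ?singvals_ge0 // sqr_singvals.
apply: (eigvals_unique (d := fun i => d i ^+ 2) Vu) => [j k le_jk|].
  by rewrite ler_sqr ?nnegrE ?d0 ?d_anti.
rewrite EF !adjM trmxCK cdiag_adj !mulmxA (mulmxtVK _ Uu).
rewrite -(mulmxA (V^t*)) cdiagM.
by congr (_ *m _ *m _); apply: eq_cdiag => j; rewrite expr2.
Qed.

(** [F F^H] and [F^H F] have the same characteristic polynomial, hence are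
    diagonalized by unitary [W] and [V] to the same diagonal matrix, so that
    [N = W F V^H] satisfies [N N^H = N^H N = diag (s ^ 2)]. Dividing the nonzero
    rows of [N] by the singular values yields orthonormal rows. A zero singular
    value kills both the row and the column of [N] with that index, so the
    missing rows can be completed by coordinate vectors, without any choice
    of a basis of the kernel. *)
Lemma svd p (F : 'M[C]_p) : exists U V : 'M[C]_p,
  [/\ U \is unitarymx, V \is unitarymx & F = U^t* *m cdiag (singvals F 0) *m V].
Proof.
have [V Vu EV] := eig_decomposition (gram_herm F).
have FF_herm := gram_herm_r F.
have [W Wu EW] := eig_decomposition FF_herm.
have E : eigvals (F *m F^t*) = eigvals (F^t* *m F).
  exact: eigvals_char_poly FF_herm (gram_herm F) (char_poly_mulC _ _).
rewrite E in EW; set lam := eigvals _ 0 in EV EW.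
pose s := singvals F 0.
have s_lam i : s i ^+ 2 = lam i by exact: sqr_singvals.
pose N := W *m F *m V^t*.
have NN : N *m N^t* = cdiag lam.
  rewrite /N !adjM trmxCK !mulmxA (mulmxKtV _ Vu) // -(mulmxA W) EW.
  by rewrite !mulmxA unitary_mul_adj // mul1mx (mulmxtVK _ Wu).
have NtN : N^t* *m N = cdiag lam.
  rewrite /N !adjM trmxCK !mulmxA (mulmxKtV _ Wu) // -(mulmxA V) EV.
  by rewrite !mulmxA unitary_mul_adj // mul1mx (mulmxtVK _ Vu).
have row0 i j : s i = 0 -> N i j = 0.
  move=> s0; have /matrixP/(_ i i) := NN.
  rewrite mxE_mul_adj cdiag_diag => /complexI; rewrite -s_lam s0 expr0n /=.
  by move=> /psumr_eq0P E0; apply/sqmod_eq0/E0 => // k _; apply: sqmod_ge0.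
have col0 i j : s j = 0 -> N i j = 0.
  move=> s0; have /matrixP/(_ j j) := NtN.
  rewrite mxE_adj_mul cdiag_diag => /complexI; rewrite -s_lam s0 expr0n /=.
  by move=> /psumr_eq0P E0; apply/sqmod_eq0/E0 => // k _; apply: sqmod_ge0.
(* rows of index [i] with [s i = 0] are completed by coordinate vectors *)
pose Q : 'M[C]_p := \matrix_(i, j)
  if s i == 0 then (i == j)%:R else ((s i)^-1)%:C * N i j.
have NQ : N = cdiag s *m Q.
  apply/matrixP => i j; rewrite cdiag_mulE [Q i j]mxE.
  case: eqP => [s0|/eqP s0]; first by rewrite row0 // s0 mul0r.
  by rewrite mulrA -realcM mulfV // mul1r.
have Qu : Q \is unitarymx.
  apply/unitarymxP/matrixP => i k; rewrite [LHS]mxE [RHS]mxE.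
  under eq_bigr => j _ do rewrite adjE [Q i j]mxE [Q k j]mxE.
  have [si0|si0] := eqVneq (s i) 0.
    rewrite (bigD1 i) //= eqxx mul1r big1 ?addr0; last first.
      by move=> j ji; rewrite eq_sym (negPf ji) mul0r.
    have [sk0|sk0] := eqVneq (s k) 0; first by rewrite eq_sym conjC_nat.
    rewrite col0 // mulr0 rmorph0.
    by case: eqP => // ik; rewrite -ik si0 eqxx in sk0.
  have [sk0|sk0] := eqVneq (s k) 0.
    rewrite big1; first by case: eqP => // ik; rewrite ik sk0 eqxx in si0.
    move=> j _; case: eqVneq => [<-|_]; last by rewrite rmorph0 mulr0.
    by rewrite col0 // mulr0 mul0r.
  have S : \sum_j N i j * Num.conj (N k j) = cdiag lam i k.
    by rewrite -NN mxE; apply: eq_bigr => j _; rewrite adjE.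
  under eq_bigr => j _ do rewrite rmorphM /= conjC_realc mulrACA.
  rewrite -mulr_sumr S !mxE; case: eqP => [<-|_]; last by rewrite mulr0n mulr0.
  by rewrite mulr1n -!realcM -s_lam expr2 mulrACA mulVf // mulr1.
exists W, (Q *m V); split; [exact: Wu | exact: (mul_unitarymx Qu Vu)|].
rewrite mulmxA -(mulmxA (W^t*)) -NQ /N !mulmxA.
by rewrite (unitary_adj_mul Wu) mul1mx (mulmxKtV _ Vu).
Qed.

Lemma singvals_adj p (F : 'M[C]_p) : singvals (F^t*) = singvals F.
Proof.
have [U [V [Uu Vu EF]]] := svd F; apply/rowP => i.
apply: (singvals_svd Vu Uu) => [||]; first exact: singvals_antitone.
  exact: singvals_ge0.
by rewrite [in LHS]EF !adjM trmxCK cdiag_adj mulmxA.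
Qed.

Lemma singvals_opp n p (F : 'M[C]_(n, p)) : singvals (- F) = singvals F.
Proof. by rewrite /singvals adjN mulNmx mulmxN opprK. Qed.

Lemma singvals_unitary_l p (F U : 'M[C]_p) : U \is unitarymx ->
  singvals (U *m F) = singvals F.
Proof.
by move=> Uu; rewrite /singvals adjM !mulmxA (mulmxKtV _ Uu).
Qed.

Lemma singvals_unitary_r p (F U : 'M[C]_p) : U \is unitarymx ->
  singvals (F *m U) = singvals F.
Proof.
move=> Uu; rewrite -(singvals_adj (F *m U)) adjM.
by rewrite (singvals_unitary_l _ (adj_unitary Uu)) singvals_adj.
Qed.

End SingularValues.


(** * Ky Fan principles and their consequences *)

Section KyFan.
Variable R : realType.
Local Notation C := R[i].

Lemma unitary_partial_sum_le1 p (A : 'M[C]_p) (J : {set 'I_p}) i :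
  A \is unitarymx -> \sum_(j in J) sqmod (A j i) <= 1.
Proof.
move=> Au; rewrite -(unitary_col_sum i Au) [leLHS]big_mkcond.
by apply: ler_sum => j _; case: ifP => // _; rewrite sqmod_ge0.
Qed.

(** In an eigenbasis of [M] a partial trace is a weighted sum of the
    eigenvalues, whose weights are partial column sums of the squared moduli of
    a unitary matrix: they lie in [[0, 1]] and add up to [#|J|]. *)
Lemma ky_fan_eigvals p (M U : 'M[C]_p) (J : {set 'I_p}) :
    M \is hermsymmx -> U \is unitarymx ->
  \sum_(j in J) complex.Re ((U *m M *m U^t*) j j) <= topsum (eigvals M 0) #|J|.
Proof.
move=> Mh Uu; have [W Wu EM] := eig_decomposition Mh.
set lam := eigvals M 0 in EM *; pose A := U *m W^t*.
have Au : A \is unitarymx := mul_unitarymx Uu (adj_unitary Wu).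
have le_Jp : (#|J| <= p)%N by rewrite -[X in (_ <= X)%N]card_ord max_card.
pose w i := \sum_(j in J) sqmod (A j i).
have -> : \sum_(j in J) complex.Re ((U *m M *m U^t*) j j) = \sum_i lam i * w i.
  under [RHS]eq_bigr => i _ do rewrite /w mulr_sumr.
  rewrite exchange_big /=; apply: eq_bigr => j _.
  have -> : U *m M *m U^t* = (A^t*)^t* *m cdiag lam *m A^t*.
    by rewrite trmxCK /A adjM trmxCK EM !mulmxA.
  rewrite spectral_entry cRe_sum; apply: eq_bigr => i _.
  by rewrite !adjE conjCK mulCJ -realcM.
apply: antitone_weighted_le => //; first exact: eigvals_antitone.
  move=> i; rewrite unitary_partial_sum_le1 // andbT.
  by apply: sumr_ge0 => *; apply: sqmod_ge0.
rewrite exchange_big /=; under eq_bigr => j _ do rewrite (unitary_row_sum j Au).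
by rewrite sumr_const.
Qed.

(** Replaces the product of the entries of two unitary matrices by the mean of
    their squared moduli, to which the bound on weighted sums applies. *)
Lemma Re_mulCJ_le (a b : C) :
  complex.Re (a * Num.conj b) <= 2^-1 * (sqmod a + sqmod b).
Proof.
case: a b => [a1 a2] [b1 b2]; rewrite /sqmod /=.
have := sqr_ge0 (a1 - b1); have := sqr_ge0 (a2 - b2); rewrite !expr2; lra.
Qed.

Lemma ky_fan_singvals p (F U V : 'M[C]_p) (J : {set 'I_p}) :
    U \is unitarymx -> V \is unitarymx ->
  \sum_(j in J) complex.Re ((U *m F *m V^t*) j j) <= topsum (singvals F 0) #|J|.
Proof.
move=> Uu Vu; have [W [Z [Wu Zu EF]]] := svd F.
set s := singvals F 0 in EF *.
pose A := U *m W^t*; pose B := V *m Z^t*.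
have Au : A \is unitarymx := mul_unitarymx Uu (adj_unitary Wu).
have Bu : B \is unitarymx := mul_unitarymx Vu (adj_unitary Zu).
have le_Jp : (#|J| <= p)%N by rewrite -[X in (_ <= X)%N]card_ord max_card.
pose w i := 2^-1 * (\sum_(j in J) sqmod (A j i) + \sum_(j in J) sqmod (B j i)).
apply: (@le_trans _ _ (\sum_i s i * w i)).
  under [leRHS]eq_bigr => i _ do rewrite /w -big_split mulr_sumr mulr_sumr /=.
  rewrite exchange_big /=; apply: ler_sum => j _.
  have -> : U *m F *m V^t* = (A^t*)^t* *m cdiag s *m B^t*.
    by rewrite trmxCK /A /B adjM trmxCK EF !mulmxA.
  rewrite spectral_entry cRe_sum; apply: ler_sum => i _.
  rewrite cReMr !adjE conjCK; apply: ler_wpM2l; first exact: singvals_ge0.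
  exact: Re_mulCJ_le.
apply: antitone_weighted_le => //; first exact: singvals_antitone.
  move=> i; rewrite /w; have := unitary_partial_sum_le1 J i Au.
  have := unitary_partial_sum_le1 J i Bu.
  have : 0 <= \sum_(j in J) sqmod (A j i).
    by apply: sumr_ge0 => *; apply: sqmod_ge0.
  have : 0 <= \sum_(j in J) sqmod (B j i).
    by apply: sumr_ge0 => *; apply: sqmod_ge0.
  by move=> *; apply/andP; split; lra.
rewrite -mulr_sumr big_split /=.
rewrite [X in X + _]exchange_big [X in _ + X]exchange_big /=.
under eq_bigr => j _ do rewrite (unitary_row_sum j Au).
under [X in _ + X]eq_bigr => j _ do rewrite (unitary_row_sum j Bu).
rewrite sumr_const; lra.
Qed.

(** The singular vectors of [E + F] turn the left-hand side into a partial
    trace, to which [E] and [F] contribute separately. *)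
Lemma singvals_add p (E F : 'M[C]_p) k : (k <= p)%N ->
  topsum (singvals (E + F) 0) k <=
  topsum (fun i => singvals E 0 i + singvals F 0 i) k.
Proof.
move=> le_kp; have [U [V [Uu Vu EF]]] := svd (E + F).
pose J := [set i : 'I_p | (i < k)%N].
have J_card : #|J| = k by rewrite card_ord_lt.
have -> : topsum (singvals (E + F) 0) k =
    \sum_(j in J) (complex.Re ((U *m E *m V^t*) j j)
                   + complex.Re ((U *m F *m V^t*) j j)).
  apply: eq_big => [i|i _]; first by rewrite inE.
  have -> : singvals (E + F) 0 i = complex.Re ((U *m (E + F) *m V^t*) i i).
    rewrite [in RHS]EF !mulmxA (unitary_mul_adj Uu) mul1mx (mulmxtVK _ Vu)//.
    by rewrite !mxE eqxx.
  by rewrite mulmxDr mulmxDl mxE cReD.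
rewrite /topsum !big_split /= -J_card; apply: lerD; exact: ky_fan_singvals.
Qed.

(** A case of Horn's inequality. The singular vectors [V] of
    [D = diag (d o s) N] give [s_i (D) ^ 2 = sum_j d_(s j) ^ 2 |Z_ji| ^ 2] with
    [Z = N V^H]. Summed over [i < k], this weights the vector
    [c_j = sum_(i < k) |Z_ji| ^ 2] by [d ^ 2]. A sum of [m] entries of [c] is at
    most a partial trace of [Z Z^H] over [m] indices, and at most a partial
    trace of [Z^H Z] over [k] indices; by Ky Fan it is bounded by the sum of the
    [min m k] largest [s_i (N) ^ 2], and Abel summation concludes. *)
Lemma sqr_singvals_diag_mul_le p (d : 'I_p -> R) (s : 'S_p) (N : 'M[C]_p) k :
    antitone d -> (forall i, 0 <= d i) -> (k <= p)%N ->
  topsum (fun i => singvals (cdiag (d \o s) *m N) 0 i ^+ 2) k <=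
  topsum (fun i => d i ^+ 2 * singvals N 0 i ^+ 2) k.
Proof.
move=> d_anti d0 le_kp; set D := cdiag (d \o s) *m N.
have ED : D = cdiag (d \o s) *m N by [].
clearbody D.
have [V Vu EV] := eig_decomposition (gram_herm D).
pose Z := N *m V^t*.
have ZE i : singvals D 0 i ^+ 2 = \sum_j d (s j) ^+ 2 * sqmod (Z j i).
  apply: complexI; rewrite sqr_singvals.
  transitivity (((D *m V^t*)^t* *m (D *m V^t*)) i i).
    rewrite (adjM D) trmxCK -mulmxA (mulmxA (D^t*)) [in RHS]EV !mulmxA.
    by rewrite (unitary_mul_adj Vu) mul1mx (mulmxtVK _ Vu)// !mxE eqxx.
  rewrite mxE_adj_mul; congr _%:C; apply: eq_bigr => j _.
  rewrite ED -mulmxA cdiag_mulE /sqmod /=; case: ((N *m V^t*) j i) => a b /=.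
  ring.
pose c j := \sum_(i < p | (i < k)%N) sqmod (Z j i).
pose x j := c ((s^-1)%g j).
pose y (i : 'I_p) := if (i < k)%N then singvals N 0 i ^+ 2 else 0.
have le_xy m : (m <= p)%N -> topsum x m <= topsum y m.
  move=> le_mp.
  have Ey l : (l <= p)%N -> (l <= k)%N ->
      topsum y l = topsum (eigvals (N^t* *m N) 0) l.
    move=> le_lp le_lk; apply: eq_bigr => i lt_il.
    by rewrite /y (leq_trans lt_il) // sqr_singvals.
  case: (leqP m k) => [le_mk|lt_km].
    rewrite Ey //.
    have -> : eigvals (N^t* *m N) = eigvals (N *m N^t*).
      exact: eigvals_char_poly (gram_herm N) (gram_herm_r N)
                               (char_poly_mulC _ _).
    pose J := (s^-1)%g @: [set l : 'I_p | (l < m)%N].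
    have J_card : #|J| = m.
      by rewrite card_imset ?card_ord_lt //; apply: perm_inj.
    rewrite -J_card.
    have NN_herm := gram_herm_r N.
    have U1 : 1%:M \is @unitarymx C p p.
      by apply/unitarymxP; rewrite mul1mx trmx1 map_mx1.
    apply: le_trans (ky_fan_eigvals J NN_herm U1).
    rewrite J_card mul1mx trmx1 map_mx1 mulmx1 big_imset /=; last first.
      by move=> ? ? _ _; apply: perm_inj.
    rewrite /topsum; under [leRHS]eq_bigl => i do rewrite inE.
    apply: ler_sum => i _; rewrite /x /c.
    set j := (s^-1)%g i.
    have -> : N *m N^t* = Z *m Z^t*.
      by rewrite /Z adjM trmxCK mulmxA (mulmxKtV _ Vu).
    rewrite mxE_mul_adj /= [leLHS]big_mkcond; apply: ler_sum => a _.
    by case: ifP => // _; rewrite sqmod_ge0.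
  have -> : topsum y m = topsum y k.
    rewrite /topsum [LHS](bigID (fun i : 'I_p => (i < k)%N)) /=.
    rewrite [X in _ + X]big1 ?addr0; last first.
      by move=> i /andP[_ nk]; rewrite /y (negPf nk).
    apply: eq_bigl => i; case: (ltnP i k) => [/leq_trans ->|] //.
      by rewrite ltnW.
    by rewrite andbF.
  rewrite Ey //.
  apply: (@le_trans _ _ (\sum_j c j)).
    rewrite [leRHS](reindex_inj (@perm_inj _ (s^-1)%g)) /=.
    rewrite /topsum [leLHS]big_mkcond.
    apply: ler_sum => i _; case: ifP => // _.
    by apply: sumr_ge0 => *; apply: sqmod_ge0.
  have := ky_fan_eigvals [set i : 'I_p | (i < k)%N] (gram_herm N) Vu.
  rewrite card_ord_lt //; apply: le_trans.
  rewrite /c exchange_big /=; under [leRHS]eq_bigl => i do rewrite inE.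
  apply: ler_sum => i _.
  have -> : V *m (N^t* *m N) *m V^t* = Z^t* *m Z.
    by rewrite /Z adjM trmxCK !mulmxA.
  by rewrite mxE_adj_mul.
have d2_anti : antitone (fun i => d i ^+ 2).
  by move=> i j le_ij; rewrite ler_sqr ?nnegrE ?d0 ?d_anti.
have := weighted_topsum_le d2_anti (fun i => sqr_ge0 _) le_xy (leqnn p).
rewrite !topsum_full => h.
have -> : topsum (fun i => singvals D 0 i ^+ 2) k = \sum_i d i ^+ 2 * x i.
  rewrite /topsum; under eq_bigr => i _ do rewrite ZE.
  rewrite exchange_big /= [RHS](reindex_inj (@perm_inj _ s)) /=.
  by apply: eq_bigr => j _; rewrite /x permK mulr_sumr.
apply: le_trans h _; rewrite /topsum [leRHS]big_mkcond; apply: ler_sum => i _.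
by rewrite /y; case: ifP => // _; rewrite mulr0.
Qed.

Lemma sqr_singvals_mul_diag_le p (d : 'I_p -> R) (s : 'S_p) (N : 'M[C]_p) k :
    antitone d -> (forall i, 0 <= d i) -> (k <= p)%N ->
  topsum (fun i => singvals (N *m cdiag (d \o s)) 0 i ^+ 2) k <=
  topsum (fun i => d i ^+ 2 * singvals N 0 i ^+ 2) k.
Proof.
rewrite -(singvals_adj (N *m _)) -(singvals_adj N) adjM cdiag_adj.
exact: sqr_singvals_diag_mul_le.
Qed.

End KyFan.


(** * Eigenvalue differences of two Hermitian matrices *)

Section Lidskii.
Variable R : realType.
Local Notation C := R[i].

Lemma eigvals_le m (M N : 'M[C]_m) tau : M \is hermsymmx -> N \is hermsymmx ->
    (forall v, qform M v <= qform N v + tau * sqnorm v) ->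
  forall i, eigvals M 0 i <= eigvals N 0 i + tau.
Proof.
move=> /eig_decomposition [U Uu EM] /eig_decomposition [V Vu EN] le_MN.
apply: (weyl_monotone Uu Vu); [exact: eigvals_antitone..|].
by rewrite -EM -EN.
Qed.

Lemma mxtrace_spectral m (U : 'M[C]_m) d : U \is unitarymx ->
  \tr (U^t* *m cdiag d *m U) = (\sum_i d i)%:C.
Proof.
move=> Uu; rewrite mxtrace_mulC mulmxA (unitary_mul_adj Uu) mul1mx realc_sum.
by apply: eq_bigr => i _; rewrite cdiag_diag.
Qed.

Lemma sum_eigvals m (M : 'M[C]_m) : M \is hermsymmx ->
  \sum_i eigvals M 0 i = complex.Re (\tr M).
Proof.
by move=> /eig_decomposition [U Uu EM]; rewrite [in RHS]EM mxtrace_spectral.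
Qed.

Lemma mxE_sub m n (M N : 'M[C]_(m, n)) i j : (M - N) i j = M i j - N i j.
Proof. by rewrite !mxE. Qed.

Lemma hermD m (M N : 'M[C]_m) : M \is hermsymmx -> N \is hermsymmx ->
  M + N \is hermsymmx.
Proof. by move=> /hermP EM /hermP EN; apply/hermP; rewrite adjD EM EN. Qed.

Lemma hermB m (M N : 'M[C]_m) : M \is hermsymmx -> N \is hermsymmx ->
  M - N \is hermsymmx.
Proof. by move=> /hermP EM /hermP EN; apply/hermP; rewrite adjB EM EN. Qed.

(** Since [D <= D + P], all differences between the sorted spectra of [D + P]
    and of [D] are nonnegative, so any partial sum of them is at most the full
    sum, which is the trace of [P]. The hypothesis on [B] then costs [tau] per
    index. *)
Lemma lidskii_one_sided m (B D P : 'M[C]_m) tau (I : {set 'I_m}) :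
    B \is hermsymmx -> D \is hermsymmx -> P \is hermsymmx ->
    (forall v, 0 <= qform P v) ->
    (forall v, qform B v <= qform (D + P) v + tau * sqnorm v) ->
  \sum_(i in I) (eigvals B 0 i - eigvals D 0 i)
    <= #|I|%:R * tau + complex.Re (\tr P).
Proof.
move=> hB hD hP P0 le_B; have hDP := hermD hD hP.
have le_BDP := eigvals_le hB hDP le_B.
have le_DDP i : eigvals D 0 i <= eigvals (D + P) 0 i.
  rewrite -[leRHS]addr0; apply: eigvals_le => // v.
  by rewrite mul0r addr0 qformD lerDl.
have -> : complex.Re (\tr P) = \sum_i (eigvals (D + P) 0 i - eigvals D 0 i).
  rewrite sumrB (sum_eigvals hDP) (sum_eigvals hD) mxtraceD cReD.
  by rewrite addrC addKr.
rewrite mulr_natl -sumr_const.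
apply: (@le_trans _ _
  (\sum_(i in I) (tau + (eigvals (D + P) 0 i - eigvals D 0 i)))).
  by apply: ler_sum => i _; rewrite addrA lerD2r addrC le_BDP.
rewrite big_split lerD2l [leLHS]big_mkcond; apply: ler_sum => i _.
by case: ifP => // _; rewrite subr_ge0.
Qed.

Lemma cdiagN m (d : 'I_m -> R) : cdiag (fun j => - d j) = - cdiag d.
Proof. by apply/matrixP => i j; rewrite !mxE rmorphN mulNrn. Qed.

(** Lidskii's inequality in threshold form: optimizing over [tau] would give
    the weak majorization of the eigenvalue differences by the absolute
    eigenvalues [kap] of [B - D]. The indices where the difference is
    nonnegative and the others are treated separately, with [P] the positive
    part of [B - D - tau] and of [D - B - tau] respectively. This form
    avoids sorting [kap] by absolute value. *)
Lemma lidskii_abs m (B D W : 'M[C]_m) (kap : 'I_m -> R) tau (I : {set 'I_m}) :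
    B \is hermsymmx -> D \is hermsymmx -> W \is unitarymx ->
    B - D = W^t* *m cdiag kap *m W -> 0 <= tau ->
  \sum_(i in I) `|eigvals B 0 i - eigvals D 0 i|
    <= #|I|%:R * tau + \sum_j Num.max (`|kap j| - tau) 0.
Proof.
move=> hB hD Wu EK tau0.
have half (B' D' : 'M[C]_m) (mu : 'I_m -> R) (J : {set 'I_m}) :
    B' \is hermsymmx -> D' \is hermsymmx ->
    B' - D' = W^t* *m cdiag mu *m W ->
  \sum_(i in J) (eigvals B' 0 i - eigvals D' 0 i)
    <= #|J|%:R * tau + \sum_j Num.max (mu j - tau) 0.
  move=> hB' hD' EK'.
  pose P := W^t* *m cdiag (fun j => Num.max (mu j - tau) 0) *m W.
  have -> : \sum_j Num.max (mu j - tau) 0 = complex.Re (\tr P).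
    by rewrite mxtrace_spectral.
  apply: (lidskii_one_sided J hB' hD' (spectral_herm _ _)) => v.
    rewrite qform_conj qform_diag; apply: sumr_ge0 => j _.
    by rewrite mulr_ge0 ?sqmod_ge0 // le_max lexx orbT.
  rewrite qformD -addrA -lerBlDl -qformB EK' !qform_conj !qform_diag.
  rewrite -(sqnorm_unitary v (adj_unitary Wu)) mulr_sumr -big_split /=.
  apply: ler_sum => j _; rewrite -mulrDl ler_wpM2r ?sqmod_ge0 //.
  by rewrite -lerBlDr le_max lexx.
have EK' : D - B = W^t* *m cdiag (fun j => - kap j) *m W.
  by rewrite -opprB EK cdiagN mulmxN mulNmx.
pose Ip := [set i in I | eigvals D 0 i <= eigvals B 0 i].
pose Im := [set i in I | ~~ (eigvals D 0 i <= eigvals B 0 i)].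
have h1 := half B D kap Ip hB hD EK.
have h2 := half D B _ Im hD hB EK'.
have -> : \sum_(i in I) `|eigvals B 0 i - eigvals D 0 i| =
    \sum_(i in Ip) (eigvals B 0 i - eigvals D 0 i)
    + \sum_(i in Im) (eigvals D 0 i - eigvals B 0 i).
  rewrite (bigID (fun i => eigvals D 0 i <= eigvals B 0 i)) /=; congr (_ + _).
    apply: eq_big => [i|i /andP[_ le_i]]; first by rewrite inE.
    by rewrite ger0_norm ?subr_ge0.
  apply: eq_big => [i|i /andP[_ le_i]]; first by rewrite inE.
  by rewrite distrC gtr0_norm ?subr_gt0 ?ltNge.
apply: le_trans (lerD h1 h2) _; rewrite addrACA -mulrDl -natrD.
have -> : (#|Ip| + #|Im|)%N = #|I|.
  rewrite -!sum1_card [RHS](bigID (fun i => eigvals D 0 i <= eigvals B 0 i)) /=.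
  by congr (_ + _)%N; apply: eq_bigl => i; rewrite inE.
rewrite lerD2l -big_split /=; apply: ler_sum => j _.
rewrite /Num.max; case: (lerP 0 (kap j)) => [k0|k0].
  rewrite ger0_norm //; do 2![case: ifP => ?]; lra.
rewrite ltr0_norm //; do 2![case: ifP => ?]; lra.
Qed.

Lemma cdiag_unitary m (e : 'I_m -> R) : (forall i, e i * e i = 1) ->
  cdiag e \is unitarymx.
Proof. by move=> e1; apply/unitarymxP; rewrite cdiag_adj cdiagM cdiag1. Qed.

(** With [G = diag g], the matrix [M = G^-1 (B - D) G] has the eigenvalues [kap]
    of [B - D]; they are the diagonal entries of a triangular form
    [Q M Q^H]. The matrix on the right-hand side differs from [M] by a
    skew-Hermitian matrix of the form [Z^H - Z], which does not contribute to
    the real parts of these entries. So the left-hand side, up to signs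
    absorbed in a diagonal unitary matrix, is the real part of a partial trace
    of the conjugate by [Q] of the matrix on the right-hand side. *)
Lemma sum_abs_eigvals_le m (B D W : 'M[C]_m) (kap g h : 'I_m -> R)
    (J : {set 'I_m}) :
    D \is hermsymmx -> W \is unitarymx ->
    B - D = W^t* *m cdiag kap *m W -> (forall i, g i * h i = 1) ->
  \sum_(j in J) `|kap j| <=
  topsum (singvals (cdiag h *m B *m cdiag g - cdiag g *m D *m cdiag h) 0) #|J|.
Proof.
move=> /hermP hD Wu EK gh1; set F := _ - _.
pose M := cdiag h *m (B - D) *m cdiag g.
have [Q Qu] : exists2 Q : 'M[C]_m,
    Q \is unitarymx & is_trig_mx (Q *m M *m Q^t*).
  have [|Q Qu] := @cotrigonalization _ m [:: M].
    by move=> ? ?; rewrite !inE => /eqP-> /eqP->.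
  by rewrite /= andbT /similar_to /= conjymx //; exists Q.
set N := Q *m M *m Q^t* => N_trig.
have chN : \prod_i ('X - (N i i)%:P) = \prod_i ('X - (kap i)%:C%:P).
  rewrite -char_poly_trig // /N -mulmxA char_poly_mulC -mulmxA.
  rewrite (unitary_adj_mul Qu) mulmx1 /M char_poly_mulC mulmxA cdiagM.
  by rewrite cdiag1 // mul1mx EK char_poly_spectral.
have [s Es] := prod_XsubC_perm chN.
(* signs turning eigenvalues into absolute values *)
pose e i : R := if 0 <= kap (s i) then 1 else -1.
have e_kap i : e i * kap (s i) = `|kap (s i)|.
  rewrite /e; case: ifP => [k0|/negbT]; first by rewrite mul1r ger0_norm.
  by rewrite -ltNge => k0; rewrite mulN1r ltr0_norm.
have eu : cdiag e \is unitarymx.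
  by apply: cdiag_unitary => i; rewrite /e; case: ifP; rewrite ?mulrNN mulr1.
pose J' := (s^-1)%g @: J.
have -> : #|J| = #|J'| by rewrite card_imset //; apply: perm_inj.
apply: le_trans (ky_fan_singvals F J' (mul_unitarymx eu Qu) Qu).
rewrite /J' big_imset /=; last by move=> ? ? _ _; apply: perm_inj.
rewrite le_eqVlt; apply/orP; left; apply/eqP; apply: eq_bigr => j _.
set i := (s^-1)%g j; have -> : j = s i by rewrite permKV.
rewrite -!mulmxA cdiag_mulE cReMr -e_kap; congr (_ * _).
pose Z := cdiag g *m D *m cdiag h.
have EZ : Z^t* = cdiag h *m D *m cdiag g.
  by rewrite /Z !adjM !cdiag_adj hD mulmxA.
have -> : F = M + (Z^t* - Z).
  by rewrite EZ /F /M mulmxBr mulmxBl addrA subrK.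
have EE : Q *m (Z^t* *m Q^t*) = (Q *m (Z *m Q^t*))^t*.
  by rewrite (adjM Q) (adjM Z) trmxCK mulmxA.
rewrite mulmxDl mulmxBl mulmxDr mulmxBr mxE cReD mxE_sub cReB EE adjE cRe_conj.
by rewrite subrr addr0 mulmxA -[Q *m M *m _]/N Es.
Qed.

(** Lidskii's inequality with the threshold taken to be the [#|I|]-th singular
    value of the right-hand matrix: sums over the eigenvalues of [B - D] above
    the threshold are bounded by its singular values, and no number of these
    can exceed the threshold by more in total than the [#|I|] largest. *)
Lemma eigvals_diff_le m (B D : 'M[C]_m) (g h : 'I_m -> R) (I : {set 'I_m}) :
    B \is hermsymmx -> D \is hermsymmx -> (forall i, g i * h i = 1) ->
  \sum_(i in I) `|eigvals B 0 i - eigvals D 0 i| <=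
  topsum (singvals (cdiag h *m B *m cdiag g - cdiag g *m D *m cdiag h) 0) #|I|.
Proof.
move=> hB hD gh1; set F := _ - _; set t := singvals F 0.
have t_anti : antitone t by apply: singvals_antitone.
have [W Wu EK] := eig_decomposition (hermB hB hD).
set kap := eigvals _ 0 in EK.
have cardE (J : {set 'I_m}) : (#|J| <= m)%N.
  by rewrite -[X in (_ <= X)%N]card_ord max_card.
case EI : #|I| => [|k].
  by move/eqP: EI; rewrite cards_eq0 => /eqP->; rewrite big_set0 topsum0.
have lt_km : (k < m)%N by rewrite -EI.
pose tau := t (Ordinal lt_km).
have tau0 : 0 <= tau by apply: singvals_ge0.
apply: le_trans (lidskii_abs I hB hD Wu EK tau0) _; rewrite EI.
pose J := [set j | tau < `|kap j|].
have -> : \sum_j Num.max (`|kap j| - tau) 0 =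
    \sum_(j in J) `|kap j| - #|J|%:R * tau.
  rewrite mulr_natl -sumr_const -sumrB [RHS]big_mkcond; apply: eq_bigr => j _.
  rewrite inE; case: ltP => [lt_j|le_j].
    by apply/max_idPl; rewrite subr_ge0 ltW.
  by apply/max_idPr; rewrite subr_le0.
have le_J := sum_abs_eigvals_le J hD Wu EK gh1.
apply: (@le_trans _ _ (k.+1%:R * tau + (topsum t #|J| - #|J|%:R * tau))).
  by rewrite lerD2l lerD2r.
have topB l : (l <= m)%N ->
    topsum t l - l%:R * tau = topsum (fun i => t i - tau) l.
  move=> le_lm; rewrite /topsum sumrB; congr (_ - _).
  rewrite -[in LHS](topsum_indicator R le_lm) mulr_suml [RHS]big_mkcond.
  by apply: eq_bigr => i _; case: ifP; rewrite ?mul1r ?mul0r.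
rewrite addrC -lerBrDr !topB // /topsum [leLHS]big_mkcond [leRHS]big_mkcond /=.
apply: ler_sum => i _; case: ifP => _; case: ltnP => lt_ik //.
- by rewrite subr_le0 /tau t_anti //= ltnW.
- by rewrite subr_ge0 /tau t_anti.
Qed.

End Lidskii.


(** * Eigenvalue differences and Sylvester operators *)

Section Sylvester.
Variable R : realType.
Local Notation C := R[i].

Lemma topsum_decreasing_ge p (v : 'rV[R]_p) k : (k <= p)%N ->
  topsum (v 0) k <= topsum (decreasing v 0) k.
Proof.
have [s Es] := decreasing_perm v.
apply: (@topsum_perm_le _ _ _ _ (s^-1)%g); first exact: decreasing_antitone.
by move=> i; rewrite Es permKV.
Qed.

Lemma antitone_rearrangement_eq p (f g : 'I_p -> R) (s : 'S_p) :
  antitone f -> antitone g -> (forall i, f i = g (s i)) -> f =1 g.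
Proof.
move=> f_anti g_anti Efg.
have E k : (k <= p)%N -> topsum f k = topsum g k.
  move=> le_kp; apply/eqP; rewrite eq_le (topsum_perm_le g_anti Efg) //=.
  apply: (topsum_perm_le (s := (s^-1)%g) f_anti) => // i.
  by rewrite Efg permKV.
move=> i; have := E i.+1 (ltn_ord i); rewrite !topsumS (E i (ltnW (ltn_ord i))).
move/addrI; congr (f _ = g _); exact: val_inj.
Qed.

(** Passes from bounds over arbitrary index sets, which is what Lidskii's
    inequality provides, to the sorted vector of squares. *)
Lemma topsum_decreasing_sqr_le p (v : 'I_p -> R) (t : 'I_p -> R) k :
    (forall i, 0 <= v i) ->
    (forall I : {set 'I_p}, \sum_(i in I) v i <= topsum t #|I|) -> (k <= p)%N ->
  topsum (decreasing (\row_i (v i ^+ 2)) 0) k <= topsum (fun i => t i ^+ 2) k.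
Proof.
move=> v0 le_vt le_kp.
have [s Es] := decreasing_perm (\row_i (v i ^+ 2)).
have Es' i : decreasing (\row_i (v i ^+ 2)) 0 i = v (s i) ^+ 2.
  by rewrite Es mxE.
rewrite (eq_topsum _ Es'); apply: topsum_sqr_le => // [i j le_ij|m le_mp].
  rewrite -ler_sqr ?nnegrE ?v0 // -!Es'.
  exact: decreasing_antitone.
have := le_vt (s @: [set i : 'I_p | (i < m)%N]).
rewrite card_imset ?card_ord_lt //; last exact: perm_inj.
rewrite big_imset /=; last by move=> ? ? _ _; apply: perm_inj.
apply: le_trans; rewrite le_eqVlt; apply/orP; left; apply/eqP.
by apply: eq_bigl => i; rewrite inE.
Qed.

Lemma herm_conj p n (M : 'M[C]_n) (U : 'M[C]_(p, n)) : M \is hermsymmx ->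
  U *m M *m U^t* \is hermsymmx.
Proof. by move/hermP => hM; apply/hermP; rewrite !adjM trmxCK hM mulmxA. Qed.

Lemma eigvals_conj_unitary p (M U : 'M[C]_p) : M \is hermsymmx ->
  U \is unitarymx -> eigvals (U *m M *m U^t*) = eigvals M.
Proof.
move=> hM Uu; apply: (eigvals_char_poly (herm_conj U hM) hM).
by rewrite -mulmxA char_poly_mulC -mulmxA (unitary_adj_mul Uu) mulmx1.
Qed.

Definition rev_perm p : 'S_p := perm (@rev_ord_inj p).

(** In the singular bases of [T] the operator [M T - T N] becomes
    [E' = B S - S D] with [S] the diagonal of the singular values. Splitting
    [S = G ^ 2], the matrix [G^-1 E' G^-1 = G^-1 B G - G D G^-1] bounds the
    eigenvalue differences; each of the two factors [G^-1] costs one factor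
    [1 / s_i (T)], these being taken in decreasing order, whence [rev_ord]. *)
Lemma eigvals_diff_sqr_le p (M N T : 'M[C]_p) k :
    M \is hermsymmx -> N \is hermsymmx ->
    (forall i, 0 < singvals T 0 i) -> (k <= p)%N ->
  topsum (decreasing (\row_i (`|eigvals M 0 i - eigvals N 0 i| ^+ 2)) 0) k <=
  topsum (fun i => (singvals T 0 (rev_ord i) ^+ 2)^-1
                   * singvals (M *m T - T *m N) 0 i ^+ 2) k.
Proof.
move=> hM hN; have [U [V [Uu Vu ET]]] := svd T.
have := @singvals_antitone _ _ _ T; move: (singvals T 0) ET => sg ET.
move=> sg_anti sg0 le_kp.
have [g [g0 gg]] : exists g : 'I_p -> R,
    (forall i, 0 < g i) /\ (forall i, g i * g i = sg i).
  exists (fun i => Num.sqrt (sg i)); split=> i; first by rewrite sqrtr_gt0.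
  by rewrite -expr2 sqr_sqrtr // ltW.
have [h hV] : exists h : 'I_p -> R, forall i, h i = (g i)^-1.
  by exists (fun i => (g i)^-1).
have h0 i : 0 < h i by rewrite hV invr_gt0.
have gh1 i : g i * h i = 1 by rewrite hV mulfV // gt_eqF.
pose d i := h (rev_ord i).
have d_anti : antitone d.
  move=> i j le_ij.
  have le_sg : sg (rev_ord i) <= sg (rev_ord j).
    by apply: sg_anti; rewrite leq_sub2l.
  have le_g : g (rev_ord i) <= g (rev_ord j).
    by rewrite -ler_sqr ?nnegrE ?(ltW (g0 _)) // !expr2 !gg.
  by rewrite /d !hV lef_pV2 ?posrE ?g0 ?le_g.
have d0 i : 0 <= d i := ltW (h0 _).
have hE : cdiag h = cdiag (d \o rev_perm p).
  by apply: eq_cdiag => i; rewrite /d /= permE rev_ordK.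
have d2_anti : antitone (fun i => d i ^+ 2).
  by move=> i j le_ij; rewrite ler_sqr ?nnegrE ?d0 ?d_anti.
pose B := U *m M *m U^t*; pose D := V *m N *m V^t*.
have hB : B \is hermsymmx by apply: herm_conj.
have hD : D \is hermsymmx by apply: herm_conj.
pose E := M *m T - T *m N.
pose E' := U *m E *m V^t*.
have s_E' : singvals E' = singvals E.
  rewrite /E' (singvals_unitary_r _ (adj_unitary Vu)).
  exact: singvals_unitary_l.
have EE' : E' = B *m cdiag sg - cdiag sg *m D.
  have TV : T *m V^t* = U^t* *m cdiag sg by rewrite ET (mulmxtVK _ Vu).
  have UT : U *m T = cdiag sg *m V.
    by rewrite ET !mulmxA (unitary_mul_adj Uu) mul1mx.
  rewrite /E' /E mulmxBr mulmxBl; congr (_ - _).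
    by rewrite /B -!mulmxA TV.
  by rewrite mulmxA UT /D !mulmxA.
pose F := cdiag h *m E' *m cdiag h.
have EF : F = cdiag h *m B *m cdiag g - cdiag g *m D *m cdiag h.
  have gE : cdiag sg = cdiag g *m cdiag g.
    by rewrite cdiagM; apply: eq_cdiag => i; rewrite gg.
  have gh : cdiag g *m cdiag h = 1%:M by rewrite cdiagM; apply: cdiag1.
  have hg : cdiag h *m cdiag g = 1%:M.
    by rewrite cdiagM; apply: cdiag1 => i; rewrite mulrC gh1.
  rewrite /F EE' gE mulmxBr mulmxBl; congr (_ - _).
    by rewrite -!mulmxA gh mulmx1.
  by rewrite !mulmxA hg mul1mx.
have le_F := topsum_decreasing_sqr_le (fun i => normr_ge0 _)
  (fun I => eigvals_diff_le I hB hD gh1) le_kp.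
rewrite -EF (eigvals_conj_unitary hM Uu) (eigvals_conj_unitary hN Vu) in le_F.
apply: le_trans le_F _; rewrite /F -mulmxA hE.
(* the left factor [G^-1]; the right one is then handled under its weight *)
apply: le_trans (sqr_singvals_diag_mul_le _ _ d_anti d0 le_kp) _.
have le_m m : (m <= p)%N ->
    topsum (fun i => singvals (E' *m cdiag (d \o rev_perm p)) 0 i ^+ 2) m <=
    topsum (fun i => d i ^+ 2 * singvals E' 0 i ^+ 2) m.
  exact: sqr_singvals_mul_diag_le.
apply: le_trans (weighted_topsum_le d2_anti (fun i => sqr_ge0 _) le_m le_kp) _.
rewrite s_E' le_eqVlt; apply/orP; left; apply/eqP; apply: eq_topsum => i.
rewrite mulrA; congr (_ * _); rewrite /d hV !exprVn -invfM; congr (_^-1).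
by rewrite -exprMn gg.
Qed.

End Sylvester.


(** * Residuals and principal angles *)

Section Subspaces.
Variable R : realType.
Local Notation C := R[i].

Lemma orthoprojE n p (X : 'M[C]_(n, p)) : X^t* *m X = 1%:M ->
  orthoproj X = X *m X^t*.
Proof.
move=> hX; pose U := X^T.
have UU : U *m U^t* = 1%:M.
  have -> : U^t* = (X^t*)^T by apply/matrixP => i j; rewrite !mxE.
  by rewrite /U -(trmx_mul (X^t*) X) hX trmx1.
have EP : proj_ortho U = U^t* *m U.
  rewrite -[LHS]mul1mx -[1%:M](subrK (U^t* *m U)) mulmxDl.
  rewrite proj_ortho_0 ?add0r ?proj_ortho_id ?submxMl //.
  by apply/orthomx1P; rewrite mulmxBl mul1mx -mulmxA UU mulmx1 subrr.
rewrite /orthoproj EP trmx_mul trmxK; congr (_ *m _).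
by apply/matrixP => i j; rewrite !mxE.
Qed.

Lemma singvals_orthoproj n p q (X : 'M[C]_(n, p)) (S : 'M[C]_(n, q)) :
  X^t* *m X = 1%:M -> singvals (orthoproj X *m S) = singvals (X^t* *m S).
Proof.
move=> hX; rewrite (orthoprojE hX) /singvals; congr (map_mx _ (eigvals _)).
rewrite !adjM trmxCK -!mulmxA; congr (_ *m (_ *m _)).
by rewrite (mulmxA (X^t*) X) hX mul1mx.
Qed.

(** The defect is the squared norm of the component of [w] orthogonal to the
    columns of [X]. *)
Lemma sqnorm_mul_isometry_le n p (X : 'M[C]_(n, p)) (w : 'rV[C]_n) :
  X^t* *m X = 1%:M -> sqnorm (w *m X) <= sqnorm w.
Proof.
move=> hX; pose z := w - w *m X *m X^t*.
have : 0 <= sqnorm z by apply: sumr_ge0 => *; apply: sqmod_ge0.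
suff -> : sqnorm z = sqnorm w - sqnorm (w *m X) by rewrite subr_ge0.
apply: complexI; rewrite rmorphB /= -!sqnormE -mxE_sub; congr ((_ : 'M__) _ _).
have zX : z *m X = 0 by rewrite mulmxBl -!mulmxA hX mulmx1 subrr.
rewrite {2}/z adjB mulmxBr (adjM (w *m X)) trmxCK (mulmxA z) zX mul0mx subr0.
by rewrite /z mulmxBl (adjM w) !mulmxA.
Qed.

Lemma singvals_le1 n p (X Y : 'M[C]_(n, p)) i :
  X^t* *m X = 1%:M -> Y^t* *m Y = 1%:M -> singvals (X^t* *m Y) 0 i <= 1.
Proof.
move=> hX hY; rewrite -(@ler_sqr _ _ 1) ?nnegrE ?singvals_ge0 ?ler01 //.
rewrite sqr_singvals expr1n.
have U1 : 1%:M \is @unitarymx C p p.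
  by apply/unitarymxP; rewrite mul1mx trmx1 map_mx1.
have E1 : (1%:M : 'M[C]_p) = 1%:M^t* *m cdiag (fun=> 1) *m 1%:M.
  by rewrite cdiag1 // !mulmx1 trmx1 map_mx1.
have h1 : (1%:M : 'M[C]_p) \is hermsymmx.
  by apply/hermP; rewrite trmx1 map_mx1.
have e1 : eigvals (1%:M : 'M[C]_p) 0 i = 1.
  exact: (eigvals_unique (d := fun=> 1) U1 _ E1).
rewrite -e1 -[leRHS]addr0; apply: (eigvals_le (gram_herm _) h1) => v.
rewrite mul0r addr0 [leRHS]/qform mulmx1 sqnormE /=.
have -> : qform ((X^t* *m Y)^t* *m (X^t* *m Y)) v = sqnorm (v *m Y^t* *m X).
  rewrite -[RHS]cRe_real -sqnormE /qform; congr (complex.Re ((_ : 'M__) _ _)).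
  by rewrite !adjM !trmxCK !mulmxA.
apply: le_trans (sqnorm_mul_isometry_le _ hX) _.
rewrite le_eqVlt; apply/orP; left; apply/eqP; apply: complexI.
by rewrite -!sqnormE adjM trmxCK !mulmxA -(mulmxA v) hY mulmx1.
Qed.

Lemma acos_anti (x y : R) : -1 <= x <= 1 -> -1 <= y <= 1 -> x <= y ->
  acos y <= acos x.
Proof.
move=> xI yI le_xy; rewrite leNgt; apply/negP => lt_acos.
have xK := acosK xI; have yK := acosK yI.
have := lt_acos; rewrite -ltr_cos ?in_itv /= ?acos_ge0 ?acos_lepi //.
by rewrite xK yK ltNge le_xy.
Qed.

(** [acos] reverses the order, so the decreasing angles belong to the increasing
    cosines. *)
Lemma principal_anglesE n p (X Y : 'M[C]_(n, p)) i :
  X^t* *m X = 1%:M -> Y^t* *m Y = 1%:M ->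
  principal_angles X Y 0 i = acos (singvals (X^t* *m Y) 0 (rev_ord i)).
Proof.
move=> hX hY; set sg := singvals _ 0.
have sgI j : -1 <= sg j <= 1.
  by rewrite singvals_le1 // andbT (le_trans _ (singvals_ge0 _ _)) // lerN10.
have [s Es] := decreasing_perm (map_mx acos (singvals (X^t* *m Y))).
apply: (@antitone_rearrangement_eq _ _ _ (fun j => acos (sg (rev_ord j)))
  (s * rev_perm p)%g).
- exact: decreasing_antitone.
- move=> j k le_jk; apply: acos_anti => //.
  by apply: singvals_antitone; rewrite leq_sub2l.
- by move=> j; rewrite [LHS]Es mxE permM permE rev_ordK.
Qed.

Lemma invariant_residual0 n p (A : 'M[C]_n) (X : 'M[C]_(n, p)) :
  X^t* *m X = 1%:M -> invariant_colspace A X -> residual A X = 0.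
Proof.
move=> hX /submxP [D /(congr1 trmx)]; rewrite !trmx_mul !trmxK => AX.
by rewrite /residual -(mulmxA _ A) AX (mulmxA (X^t*)) hX mul1mx subrr.
Qed.

(** The terms [X^H A Y] of the two projected residuals cancel. *)
Lemma sylvester_residuals n p (A : 'M[C]_n) (X Y : 'M[C]_(n, p)) :
  A \is hermsymmx ->
  (X^t* *m A *m X) *m (X^t* *m Y) - (X^t* *m Y) *m (Y^t* *m A *m Y) =
  - (Y^t* *m residual A X)^t* + X^t* *m residual A Y.
Proof.
move=> /hermP hA; rewrite /residual !mulmxBr adjB !adjM !trmxCK hA !mulmxA.
by rewrite opprB addrA subrK.
Qed.

(** Both parts of the theorem follow from this bound, which leaves open how the
    singular values of the combined residual are estimated. *)
Lemma ritz_bound n p (A : 'M[C]_n) (X Y : 'M[C]_(n, p)) (a : 'I_p -> R) :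
    A \is hermsymmx -> X^t* *m X = 1%:M -> Y^t* *m Y = 1%:M ->
    (forall i, principal_angles X Y 0 i < pi / 2) ->
    (forall m, (m <= p)%N ->
      topsum (singvals (- (Y^t* *m residual A X)^t* + X^t* *m residual A Y) 0) m
      <= topsum a m) ->
  weakly_majorized
    (\row_(i < p)
      `|eigvals (X^t* *m A *m X) 0 i - eigvals (Y^t* *m A *m Y) 0 i| ^+ 2)
    (\row_(i < p) (a i ^+ 2 / cos (principal_angles X Y 0 i) ^+ 2)).
Proof.
move=> hA hX hY hangle le_a k /andP[_ le_kp].
have hM : X^t* *m A *m X \is hermsymmx.
  by have := herm_conj (X^t*) hA; rewrite trmxCK.
have hN : Y^t* *m A *m Y \is hermsymmx.
  by have := herm_conj (Y^t*) hA; rewrite trmxCK.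
set sg := singvals (X^t* *m Y) 0.
have sgI j : -1 <= sg j <= 1.
  by rewrite singvals_le1 // andbT (le_trans _ (singvals_ge0 _ _)) // lerN10.
have sg0 j : 0 < sg j.
  rewrite lt_def singvals_ge0 andbT.
  apply: contraTneq (hangle (rev_ord j)) => sj0.
  by rewrite principal_anglesE // rev_ordK -/sg sj0 acos0 ltxx.
have cosE i : cos (principal_angles X Y 0 i) = sg (rev_ord i).
  by rewrite principal_anglesE // acosK // in_itv /= sgI.
have c_anti : antitone (fun i => (sg (rev_ord i) ^+ 2)^-1).
  move=> i j le_ij; rewrite lef_pV2 ?posrE ?exprn_gt0 //.
  rewrite ler_sqr ?nnegrE ?singvals_ge0 //.
  by apply: singvals_antitone; rewrite leq_sub2l.
have c_ge0 i : 0 <= (sg (rev_ord i) ^+ 2)^-1 by rewrite invr_ge0 sqr_ge0.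
apply: le_trans (eigvals_diff_sqr_le hM hN sg0 le_kp) _.
rewrite (sylvester_residuals _ _ hA).
have le_sq m : (m <= p)%N -> _ := fun le_mp =>
  topsum_sqr_le (@singvals_antitone _ _ _ _) (singvals_ge0 _) le_a le_mp.
apply: le_trans (weighted_topsum_le c_anti c_ge0 le_sq le_kp) _.
apply: le_trans (topsum_decreasing_ge _ le_kp).
by apply: ler_topsum => i; rewrite mxE cosE mulrC.
Qed.

End Subspaces.

Theorem theorem4p2 (R : realType) (n p : nat) (A : 'M[R[i]]_n)
    (X Y : 'M[R[i]]_(n, p))
    (hA : A \is hermsymmx)
    (hX : X ^t* *m X = 1%:M)
    (hY : Y ^t* *m Y = 1%:M)
    (hangle : forall i : 'I_p, principal_angles X Y 0 i < pi / 2) :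
  ((\row_(i < p)
      `|eigvals (X ^t* *m A *m X) 0 i - eigvals (Y ^t* *m A *m Y) 0 i| ^+ 2)
   ≺w
   (\row_(i < p)
      ((singvals (orthoproj Y *m residual A X) 0 i
        + singvals (orthoproj X *m residual A Y) 0 i) ^+ 2
       / cos (principal_angles X Y 0 i) ^+ 2)))
  /\
  (invariant_colspace A X ->
   (\row_(i < p)
      `|eigvals (X ^t* *m A *m X) 0 i - eigvals (Y ^t* *m A *m Y) 0 i| ^+ 2)
   ≺w
   (\row_(i < p)
      (singvals (orthoproj X *m residual A Y) 0 i ^+ 2
       / cos (principal_angles X Y 0 i) ^+ 2))).
Proof.
rewrite (singvals_orthoproj _ hX) (singvals_orthoproj _ hY).
split=> [|X_inv]; apply: (ritz_bound hA hX hY hangle) => m le_mp.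
  apply: le_trans (singvals_add _ _ le_mp) _.
  by rewrite singvals_opp singvals_adj.
by rewrite (invariant_residual0 hX X_inv) mulmx0 trmx0 map_mx0 oppr0 add0r.
Qed.
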